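(* Let $\alpha=\ell/k\in[0,1]$ be a rational number written in lowest terms ($\ell,k$ coprime nonnegative integers, $k\ge 1$). There is a constant $C\ge 0$ depending only on $\alpha$ such that for every positive integer $n$ there exists an instance of $\alpha$-ICD with $n$ agents for which every exact solution uses at least $\frac{2(k-1)}{k}\cdot n - C$ cuts.
   Context: $\alpha$-Imbalanced-Consensus-Division ($\alpha$-ICD): an instance with $n$ agents consists of $n$ probability measures $\mu_1,\dots,\mu_n$ on $[0,1]$, each absolutely continuous with a piecewise-constant density (a step function with finitely many pieces). A solution with $c$ cuts is given by cut points $0<t_1<\dots<t_c<1$, which partition $[0,1]$ into $c+1$ subintervals, each labelled ''$+$'' or ''$-$''; $A_+$ is the union of the ''$+$'' subintervals and $A_-$ the union of the ''$-$'' subintervals. The solution is exact if $\mu_i(A_+)=\alpha$ for every $i\in[n]$, and $\varepsilon$-approximate if $|\mu_i(A_+)-\alpha|\le\varepsilon$ for every $i\in[n]$. *)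

(* Defs.v *)
From HB Require Import structures.
From mathcomp Require Import all_boot all_order all_algebra.
From mathcomp Require Import all_classical all_reals all_analysis.

Set Implicit Arguments.
Unset Strict Implicit.
Unset Printing Implicit Defensive.

Import Order.TTheory GRing.Theory Num.Theory.
Import numFieldNormedType.Exports.

Local Open Scope classical_set_scope.
Local Open Scope ring_scope.

Section ImbalancedConsensusDivision.
Variable R : realType.

(* [subdivision t] says that 0 < t_1 < ... < t_c < 1, and [node t 0], ...,
   [node t c.+1] are then the points 0, t_1, ..., t_c, 1. *)
Definition subdivision (t : seq R) : bool := path <%R 0 (rcons t 1).

Definition node (t : seq R) (j : nat) : R := nth 1 (0 :: rcons t 1) j.

(* The values at the finitely many breakpoints are left unconstrained. *)
Definition step_function (f : R -> R) : Prop :=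
  exists2 t : seq R, subdivision t &
    forall j, (j <= size t)%N ->
      exists v : R, forall x, x \in `]node t j, node t j.+1[ -> f x = v.

(* A measure on [0, 1] is represented as a Borel measure on R that vanishes
   outside of [0, 1]. *)
Definition has_step_density (mu : set (measurableTypeR R) -> \bar R) : Prop :=
  exists f : R -> R,
    [/\ step_function f,
        forall x : R, x \in `[0, 1] -> 0 <= f x &
        forall A : set (measurableTypeR R), measurable A ->
          mu A = (\int[lebesgue_measure]_(x in A `&` `[0%R, 1%R]) (f x)%:E)%E].

Record icd_instance (n : nat) := IcdInstance {
  icd_measure :> 'I_n -> probability (measurableTypeR R) R;
  icd_density : forall i, has_step_density (icd_measure i) }.

(* The label [true] stands for "+", [false] for "-". *)
Record icd_division (c : nat) := IcdDivision {
  cuts : c.-tuple R;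
  cutsP : subdivision cuts;
  label : 'I_c.+1 -> bool }.

(* The pieces are [0, t_1], ]t_1, t_2], ..., ]t_c, 1]; they are disjoint and
   cover [0, 1]. *)
Definition piece (c : nat) (D : icd_division c) (j : 'I_c.+1) : set R :=
  [set` Interval (BSide (j == ord0) (node (cuts D) j))
                 (BRight (node (cuts D) j.+1))].

Definition plus_part (c : nat) (D : icd_division c) : set R :=
  \bigcup_(j in [set j | label D j]) piece D j.

Definition exact_solution (alpha : R) (n c : nat) (I : icd_instance n)
    (D : icd_division c) : Prop :=
  forall i : 'I_n, I i (plus_part D) = alpha%:E.

End ImbalancedConsensusDivision.

(* Main.v *)
Require Import Defs.
From HB Require Import structures.
From mathcomp Require Import all_boot all_order all_algebra.
From mathcomp Require Import all_classical all_reals all_analysis.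
From mathcomp Require Import measurable_realfun.
From mathcomp Require Import ring lra zify.

Set Implicit Arguments.
Unset Strict Implicit.
Unset Printing Implicit Defensive.

Import Order.TTheory GRing.Theory Num.Theory.
Local Open Scope ring_scope.

(* Choose s with s l = q k + 1. Cut [0, 1] into 2 s (n-1) equal cells. The last
   agent is uniform on the even cells; the odd cells are dealt cyclically to the
   other n-1 agents, s cells each, and each of these agents is uniform on its
   cells. Let K be the positive part of an exact solution. Averaging over the
   position inside a cell yields, for each of the first n-1 agents, a position at
   which at least s l / k, hence at least q + 1, of its s cells are in K, and for
   the last agent a position at which at most s (n-1) l / k = (n-1)(q + 1/k) of
   the even cells are in K. These sample points alternate between odd and even
   cells, and each change of membership in K costs a cut, so there are at least
   2 (n-1)(q + 1) - 2 (n-1)(q + 1/k) - 1 = 2 (n-1)(k-1)/k - 1 cuts. *)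

(** * Averaging: points that lie in many, or in few, of finitely many sets *)

Section Sampling.
Local Open Scope classical_set_scope.
Local Open Scope ereal_scope.

Section counting.
Context (d : measure_display) (T : measurableType d) (R : realType).
Variables (mu : {measure set T -> \bar R}) (D : set T) (mD : measurable D).
Variables (m : nat) (B : 'I_m -> set T) (mB : forall j, measurable (B j)).

Let hits (x : T) : nat := (\sum_(j < m) (x \in B j))%N.

Let integral_hits :
  \int[mu]_(x in D) (hits x)%:R%:E = \sum_(j < m) mu (B j `&` D).
Proof.
transitivity (\int[mu]_(x in D) (\sum_(j < m) (\1_(B j) x)%:E)).
  by apply: eq_integral => x _; rewrite sumEFin /hits natr_sum.
rewrite ge0_integral_sum//; last first.
  by move=> j; apply/measurable_EFinP; exact: measurable_indic.
by apply: eq_bigr => j _; rewrite integral_indic.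
Qed.

Let measurable_hits : measurable_fun D (fun x => (hits x)%:R%:E : \bar R).
Proof.
rewrite (_ : (fun x => _) = (fun x => \sum_(j < m) (\1_(B j) x)%:E)).
  by apply: emeasurable_sum => j; apply/measurable_EFinP; exact: measurable_indic.
by apply/funext => x; rewrite sumEFin /hits natr_sum.
Qed.

(** The number of sets [B j] containing a point is at most [m], so it attains a maximum on [D]. Its
    integral over [D] is the sum of the measures, and is at most this maximum times [mu D]. *)
Lemma exists_hits_ge : D !=set0 -> exists2 x, D x &
  \sum_(j < m) mu (B j `&` D) <= (\sum_(j < m) (x \in B j))%N%:R%:E * mu D.
Proof.
move=> [x0 Dx0].
have ubP n : `[< exists2 x, D x & hits x = n >] -> (n <= m)%N.
  move=> /asboolP[x _ <-]; rewrite -[leqRHS]card_ord -sum1_card.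
  by apply: leq_sum => j _; exact: leq_b1.
have exP : exists n, `[< exists2 x, D x & hits x = n >].
  by exists (hits x0); apply/asboolP; exists x0.
case: (ex_maxnP exP ubP) => n /asboolP[x Dx xn] nmax.
exists x => //; rewrite -/(hits x) xn -integral_hits -integral_cst//.
apply: ge0_le_integral => // y Dy.
by rewrite lee_fin ler_nat; apply: nmax; apply/asboolP; exists y.
Qed.

Lemma exists_hits_le : D !=set0 -> exists2 x, D x &
  (\sum_(j < m) (x \in B j))%N%:R%:E * mu D <= \sum_(j < m) mu (B j `&` D).
Proof.
move=> [x0 Dx0].
have exP : exists n, `[< exists2 x, D x & hits x = n >].
  by exists (hits x0); apply/asboolP; exists x0.
case: (ex_minnP exP) => n /asboolP[x Dx xn] nmin.
exists x => //; rewrite -/(hits x) xn -integral_hits -integral_cst//.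
apply: ge0_le_integral => // [y _|y Dy]; first by rewrite lee_fin.
by rewrite lee_fin ler_nat; apply: nmin; apply/asboolP; exists y.
Qed.

End counting.
End Sampling.

(** * Equal cells of the unit interval and measures uniform on some of them *)

Section Cells.
Context (R : realType).
Local Open Scope classical_set_scope.
Local Notation leb := (@lebesgue_measure R).

(** The pushforward under translation agrees with Lebesgue measure on half-open intervals, which
    determines it. *)
Lemma lebesgue_measure_shift (a : R) (A : set R) :
  measurable A -> leb [set x | A (a + x)] = leb A.
Proof.
pose g (x : measurableTypeR R) : measurableTypeR R := a + x.
have mg : measurable_fun setT g.
  by apply: measurable_funD => //; exact: measurable_cst.
pose f : {mfun measurableTypeR R >-> measurableTypeR R} :=
  HB.pack g (@isMeasurableFun.Build _ _ _ _ _ mg).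
move=> mA; apply/esym/(@lebesgue_measure_unique _ (pushforward leb f)) => //=.
move=> _ [[u v]] _ <-.
rewrite /pushforward.
have -> : f @^-1` `]u, v] = `]u - a, v - a].
  by apply/seteqP; split => x; rewrite /= !in_itv/= ltrBlDl lerBrDl.
rewrite !lebesgue_measure_itv/= !lte_fin ltrD2r -!EFinB.
by congr (if _ then _%:E else _); ring.
Qed.

(** Half-open, so that the cells are disjoint translates of [cell M 0] and contain only positive
    points. *)
Definition cell (M t : nat) : set R := `]t%:R / M%:R, t.+1%:R / M%:R].

Lemma measurable_cell M t : measurable (cell M t : set (measurableTypeR R)).
Proof. exact: measurable_itv. Qed.

Lemma cellE M t : cell M t = `]t%:R / M%:R, t%:R / M%:R + M%:R^-1].
Proof. by rewrite /cell -natr1 mulrDl mul1r. Qed.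

Lemma cell0E M (x : R) : cell M 0 x = (0 < x <= M%:R^-1).
Proof. by rewrite cellE /= in_itv/= mul0r add0r. Qed.

Lemma lebesgue_measure_cell M t : (0 < M)%N -> leb (cell M t) = (M%:R^-1)%:E.
Proof.
move=> M0; rewrite cellE lebesgue_measure_itv/= lte_fin ltrDl invr_gt0 ltr0n M0.
by rewrite -EFinB addrAC subrr add0r.
Qed.

Lemma lebesgue_measure_setI_cell M t (A : set R) : measurable A ->
  leb (A `&` cell M t) = leb ([set x | A (t%:R / M%:R + x)] `&` cell M 0).
Proof.
move=> mA; rewrite -(lebesgue_measure_shift (t%:R / M%:R)); last first.
  by apply: measurableI => //; exact: measurable_cell.
congr (leb _); apply/seteqP.
by split=> x [Ax tx]; split=> //; move: tx;
  rewrite /= !cellE /= !in_itv/= mul0r add0r ltrDl lerD2l.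
Qed.

Lemma cell_sub01 M t : (t < M)%N -> cell M t `<=` `[0, 1].
Proof.
move=> tM x; have M0 : 0 < M%:R :> R by rewrite ltr0n (leq_trans _ tM).
rewrite /cell /= !in_itv/= => /andP[tx xt]; apply/andP; split.
  by rewrite ltW// (le_lt_trans _ tx)// divr_ge0.
by rewrite (le_trans xt)// ler_pdivrMr// mul1r ler_nat.
Qed.

Definition grid (M : nat) : seq R := [seq i.+1%:R / M%:R | i <- iota 0 M.-1].

Lemma size_grid M : size (grid M) = M.-1.
Proof. by rewrite size_map size_iota. Qed.

Lemma nodes_grid M : (0 < M)%N ->
  0 :: rcons (grid M) 1 = [seq i%:R / M%:R | i <- iota 0 M.+1].
Proof.
case: M => // M _; rewrite -[iota 0 M.+2]/(0%N :: iota 1 M.+1) map_cons mul0r.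
have -> : iota 1 M.+1 = rcons [seq i.+1 | i <- iota 0 M] M.+1.
  by have := iotaD 1 M 1; rewrite addn1 => ->; rewrite -cats1 (iotaDl 1 0).
by rewrite map_rcons -map_comp divff// pnatr_eq0.
Qed.

Lemma subdivision_grid M : (0 < M)%N -> subdivision (grid M).
Proof.
move=> M0; rewrite /subdivision -/(sorted _ (0 :: rcons _ _)) nodes_grid//.
apply: homo_sorted (iota_ltn_sorted 0 M.+1) => i j ij.
by rewrite ltr_pM2r ?ltr_nat// invr_gt0 ltr0n.
Qed.

Lemma node_grid M j : (0 < M)%N -> (j <= M)%N -> node (grid M) j = j%:R / M%:R.
Proof.
move=> M0 jM; rewrite /node nodes_grid// (nth_map 0%N) ?size_iota//.
by rewrite nth_iota.
Qed.

Lemma mem_cell_gridE M t j (x : R) : (0 < M)%N ->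
  x \in `]j%:R / M%:R, j.+1%:R / M%:R[%R -> (x \in cell M t) = (t == j).
Proof.
move=> M0; have M_gt0 : 0 < M%:R :> R by rewrite ltr0n.
rewrite in_itv/= ltr_pdivrMr// ltr_pdivlMr// => /andP[jx xj].
apply/idP/eqP => [|->]; rewrite inE /cell /= in_itv/= ltr_pdivrMr// ler_pdivlMr//.
  move=> /andP[tx xt]; apply/eqP; rewrite eqn_leq.
  have := lt_trans tx xj; have := lt_le_trans jx xt.
  by rewrite !ltr_nat !ltnS => -> ->.
by rewrite jx ltW.
Qed.

(** The measure is a rescaled sum of restrictions of Lebesgue measure to the cells [e j], a repeated
    cell counting with multiplicity. Its density is constant between consecutive grid points. *)
Lemma exists_cells_uniform (M m : nat) (e : nat -> nat) :
  (0 < M)%N -> (0 < m)%N -> (forall j, (j < m)%N -> (e j < M)%N) ->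
  exists P : probability (measurableTypeR R) R, has_step_density P /\
    forall A : set R, measurable A ->
      P A = ((M%:R / m%:R)%:E * \sum_(j < m) leb (A `&` cell M (e j)))%E.
Proof.
move=> M0 m0 eM.
have Mm0 : 0 <= M%:R / m%:R :> R by rewrite divr_ge0.
pose mu := mscale (NngNum Mm0)
  (msum (fun j => mrestr leb (measurable_cell M (e j))) m).
have muE A : mu A = ((M%:R / m%:R)%:E * \sum_(j < m) leb (A `&` cell M (e j)))%E.
  by [].
have mu1 : mu setT = 1%:E.
  rewrite muE (eq_bigr (fun=> (M%:R^-1)%:E)); last first.
    by move=> j _; rewrite setTI lebesgue_measure_cell.
  rewrite sumEFin sumr_const card_ord -EFinM; congr _%:E.
  rewrite -[_ *+ m]mulr_natl; field.
  by rewrite !pnatr_eq0 -!lt0n M0 m0.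
pose P : probability (measurableTypeR R) R :=
  HB.pack mu (@Measure_isProbability.Build _ _ R mu mu1).
exists P; split=> //.
pose f (x : R) : R := M%:R / m%:R * \sum_(j < m) \1_(cell M (e j)) x.
exists f; split.
- exists (grid M); first exact: subdivision_grid.
  rewrite size_grid => j jM.
  exists (M%:R / m%:R * \sum_(i < m) (e i == j)%:R) => x.
  rewrite !node_grid//; [|lia..] => xj.
  congr (_ * _); apply: eq_bigr => i _.
  by rewrite indicE (mem_cell_gridE _ M0 xj).
- move=> x _; apply: mulr_ge0; first by rewrite divr_ge0.
  by apply: sumr_ge0 => j _.
- move=> A mA; rewrite /= muE.
  have mA01 : measurable (A `&` `[0, 1] : set (measurableTypeR R)).
    by apply: measurableI => //; exact: measurable_itv.
  rewrite /f; under eq_integral do rewrite EFinM -sumEFin.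
  rewrite ge0_integralZl_EFin//; last 2 first.
    + by move=> x _; apply: sume_ge0 => j _; rewrite lee_fin.
    + apply: emeasurable_sum => j; apply/measurable_EFinP.
      by apply: measurable_indic; exact: measurable_cell.
  rewrite ge0_integral_sum//; last first.
    move=> j; apply/measurable_EFinP.
    by apply: measurable_indic; exact: measurable_cell.
  congr (_ * _)%E; apply: eq_bigr => j _.
  rewrite integral_indic//; last exact: measurable_cell.
  rewrite setICA; congr (leb (_ `&` _)); apply/esym/setIidPl.
  exact/cell_sub01/eM.
Qed.

Section offsets.
Variables (M m : nat) (e : nat -> nat) (A : set R) (b : R).
Hypotheses (M_gt0 : (0 < M)%N) (m_gt0 : (0 < m)%N) (mA : measurable A).
Hypothesis avgA :
  ((M%:R / m%:R)%:E * \sum_(j < m) leb (A `&` cell M (e j)))%E = b%:E.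

Let translate (j : 'I_m) : set R := [set x | A ((e j)%:R / M%:R + x)].

Let measurable_translate j :
  measurable (translate j : set (measurableTypeR R)).
Proof.
have := @measurable_funD _ _ _ setT (cst ((e j)%:R / M%:R)) (@id (measurableTypeR R))
  (measurable_cst _) (@measurable_id _ _ _).
by move=> /(_ measurableT _ mA); rewrite setTI.
Qed.

Let sum_translate :
  (\sum_(j < m) leb (translate j `&` cell M 0) = (b * m%:R / M%:R)%:E)%E.
Proof.
have M0 : M%:R != 0 :> R by rewrite pnatr_eq0 -lt0n.
have m0 : m%:R != 0 :> R by rewrite pnatr_eq0 -lt0n.
under eq_bigr do rewrite -lebesgue_measure_setI_cell//.
rewrite -mulrA EFinM -avgA muleAC -EFinM.
by rewrite (_ : _ * _ = 1) ?mul1e//; field; rewrite M0.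
Qed.

Let cell0 : cell M 0 !=set0.
Proof.
by exists M%:R^-1; rewrite cell0E lexx andbT invr_gt0 ltr0n.
Qed.

(** Moving all [m] cells onto [cell M 0] makes the traces of [A] subsets of one cell, with total
    measure [b * m / M]; averaging over that cell, of measure [1 / M], gives the offset. *)
Lemma exists_offset_ge : exists2 x, cell M 0 x &
  b * m%:R <= (\sum_(j < m) (((e j)%:R / M%:R + x)%R \in A))%N%:R.
Proof.
have [x x0] := exists_hits_ge leb (measurable_cell M 0) measurable_translate cell0.
rewrite sum_translate [X in (_ * X)%E](lebesgue_measure_cell 0 M_gt0) -EFinM lee_fin => le_x.
by exists x => //; move: le_x; rewrite ler_pM2r ?invr_gt0 ?ltr0n.
Qed.

Lemma exists_offset_le : exists2 x, cell M 0 x &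
  (\sum_(j < m) (((e j)%:R / M%:R + x)%R \in A))%N%:R <= b * m%:R.
Proof.
have [x x0] := exists_hits_le leb (measurable_cell M 0) measurable_translate cell0.
rewrite sum_translate [X in (_ * X)%E](lebesgue_measure_cell 0 M_gt0) -EFinM lee_fin => le_x.
by exists x => //; move: le_x; rewrite ler_pM2r ?invr_gt0 ?ltr0n.
Qed.

End offsets.

End Cells.

(** * Summation lemmas *)

Lemma telescope_alternating (p q F : nat -> nat) (L : nat) :
  (forall t, 2 * p t + F t <= q t + q t.+1 + F t.+1)%N ->
  (2 * \sum_(t < L) p t <= 2 * \sum_(t < L) q t + (q L + F L))%N.
Proof.
move=> pqF.
(* Keeping the initial terms makes the induction go through: each inner [q t] occurs twice, and [F]
   telescopes. *)
have : (2 * \sum_(t < L) p t + (q 0%N + F 0%N)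
    <= 2 * \sum_(t < L) q t + (q L + F L))%N.
  elim: L => [|L]; first by rewrite !big_ord0.
  by rewrite !big_ord_recr/=; have := pqF L; lia.
by lia.
Qed.

Lemma sum_ord_mul (F : nat -> nat) (s N : nat) :
  (\sum_(t < s * N) F t = \sum_(i < N) \sum_(j < s) F (j * N + i))%N.
Proof.
rewrite -(big_mkord xpredT F) big_nat_mul big_mkord exchange_big/=.
apply: eq_bigr => j _; rewrite -{1}[(j * N)%N]add0n big_addn mulSn addnK big_mkord.
by apply: eq_bigr => i _; rewrite addnC.
Qed.

(** * Changes of membership in the positive part, counted by cuts *)

Section CountingCuts.
Context (R : realType) (c : nat) (D : icd_division R c).
Local Open Scope classical_set_scope.

(** In an increasing list the entries below [x] form a prefix. *)
Lemma nth_lt_count (s : seq R) (x0 x : R) (j : nat) :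
  sorted <%R s -> (j < size s)%N ->
  (nth x0 s j < x) = (j < count (fun u => (u < x)%R) s)%N.
Proof.
elim: s j => [//|a s IH] j /= pas.
have min_a : all (fun b => a < b) s by apply: order_path_min pas; exact: lt_trans.
case: (ltP a x) => ax.
  case: j => [//|j] /= js; rewrite add1n ltnS IH//; exact: path_sorted pas.
have c0 : count (fun u => (u < x)) s = 0%N.
  apply/eqP; rewrite -leqn0 leqNgt -has_count; apply/hasPn => b /(allP min_a) ab.
  by rewrite -leNgt (le_trans ax)// ltW.
rewrite c0 => js; apply/negbTE; rewrite -leNgt.
case: j js => [//|j] /= js; rewrite (le_trans ax)// ltW//.
by apply: (allP min_a); exact: mem_nth.
Qed.

(* Counting [1] as a cut places the points beyond 1 in a piece of their own. *)
Definition cuts_below (x : R) : nat := count (fun u => u < x) (rcons (cuts D) 1).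

Lemma cuts_below_le (x y : R) : x <= y -> (cuts_below x <= cuts_below y)%N.
Proof. by move=> xy; apply: sub_count => u /= /lt_le_trans; apply. Qed.

Lemma mem_plus_part (x : R) : 0 < x ->
  plus_part D x <-> exists2 j : 'I_c.+1, label D j & cuts_below x = j.
Proof.
move=> x0.
have srt : sorted <%R (rcons (cuts D) 1) by exact: path_sorted (cutsP D).
have sz : size (rcons (cuts D) 1) = c.+1 by rewrite size_rcons size_tuple.
(* For positive points the closed left end of the first piece makes no difference, so the index of a
   piece is the number of cuts below its points. *)
have pieceE (j : 'I_c.+1) : piece D j x <-> cuts_below x = j.
  have nodeS i : (i < c.+1)%N -> (node (cuts D) i.+1 < x) = (i < cuts_below x)%N.
    by move=> ic; rewrite /node /= nth_lt_count ?sz.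
  have -> : piece D j x <-> (node (cuts D) j < x) && (x <= node (cuts D) j.+1).
    rewrite /piece /=; case: eqP => [->|_]; last by rewrite in_itv.
    by rewrite in_itv /= /node /= x0 (ltW x0).
  rewrite (leNgt x) nodeS// -leqNgt; have := ltn_ord j.
  case: (nat_of_ord j) => [|i] ic.
    by rewrite {1}/node /= x0 leqn0; split=> /eqP.
  by rewrite nodeS; [split=> [/andP[]|]; lia|exact: ltnW].
split=> [[j /= lj /pieceE jx]|[j lj jx]]; first by exists j.
by exists j => //; apply/pieceE.
Qed.

Lemma measurable_plus_part : measurable (plus_part D : set (measurableTypeR R)).
Proof.
apply: fin_bigcup_measurable => [|j _]; first exact: finite_finset.
exact: measurable_itv.
Qed.

Lemma plus_part_cuts_below (x y : R) : 0 < x -> 0 < y ->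
  cuts_below x = cuts_below y -> (x \in plus_part D) = (y \in plus_part D).
Proof.
move=> x0 y0 xy; apply/idP/idP; rewrite !inE => /mem_plus_part H;
  apply/mem_plus_part => //; case: (H _) => // j lj jx; exists j => //.
  by rewrite -xy.
by rewrite xy.
Qed.

(** Equal cut counts force equal membership; otherwise the count rises by at least one, which
    absorbs any change of membership. *)
Lemma plus_part_variation (x y : R) : 0 < x -> x <= y ->
  ((x \in plus_part D) + cuts_below x <= (y \in plus_part D) + cuts_below y)%N /\
  ((y \in plus_part D) + cuts_below x <= (x \in plus_part D) + cuts_below y)%N.
Proof.
move=> x0 xy; have y0 := lt_le_trans x0 xy; have := cuts_below_le xy.
rewrite leq_eqVlt => /predU1P[e|e]; first by rewrite (plus_part_cuts_below _ _ e) ?e.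
by case: (_ \in _); case: (_ \in _); lia.
Qed.

(** A point of the positive part lies in a piece of index at most [c], which leaves room for the
    membership term; any other point has at most [c.+1] entries below it. *)
Lemma plus_part_cuts_below_le (x : R) : 0 < x ->
  ((x \in plus_part D) + cuts_below x <= c.+1)%N.
Proof.
move=> x0; case: (boolP (x \in _)) => [|_].
  by rewrite inE => /mem_plus_part -/(_ x0)[j _ ->]; exact: ltn_ord.
by rewrite (leq_trans (count_size _ _))// size_rcons size_tuple.
Qed.

(** Each [z t] is compared with both neighbours [v t] and [v t.+1], hence the factor 2: a positive
    [z t] between two negative neighbours costs two cuts. *)
Lemma alternating_sample (v z : nat -> R) (L : nat) : 0 < v 0%N ->
  (forall t, v t <= z t) -> (forall t, z t <= v t.+1) ->
  (2 * \sum_(t < L) (z t \in plus_part D)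
     <= 2 * \sum_(t < L) (v t \in plus_part D) + c.+1)%N.
Proof.
move=> v0 vz zv.
have v_gt0 t : 0 < v t.
  by elim: t => // t IH; rewrite (lt_le_trans IH)// (le_trans (vz t)).
have step t : (2 * (z t \in plus_part D) + cuts_below (v t)
    <= (v t \in plus_part D) + (v t.+1 \in plus_part D) + cuts_below (v t.+1))%N.
  have [_] := plus_part_variation (v_gt0 t) (vz t).
  have [+ _] := plus_part_variation (lt_le_trans (v_gt0 t) (vz t)) (zv t).
  by case: (_ \in _); case: (_ \in _); case: (_ \in _); lia.
have := telescope_alternating L step.
have := plus_part_cuts_below_le (v_gt0 L); lia.
Qed.

End CountingCuts.

(** These are Bezout coefficients; [s = 0] would make the left side vanish. *)
Lemma exists_inverse_mod (l k : nat) : (0 < l)%N -> coprime l k ->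
  exists s q : nat, (s * l = q * k + 1)%N /\ (0 < s)%N.
Proof.
move=> l0 /eqP lk; case: (egcdnP k l0) => s q + _; rewrite lk => e.
by exists s, q; split=> //; case: s e => //; lia.
Qed.

(** * The cyclic instance with [N.+1] agents *)

Section LowerBound.
Context (R : realType) (N s l k q : nat).
Hypotheses (N_gt0 : (0 < N)%N) (k_gt0 : (0 < k)%N) (s_gt0 : (0 < s)%N).
Hypothesis slE : (s * l = q * k + 1)%N.

Let M := (2 * (s * N))%N.
(** Agent [i < N] receives every [N]-th odd cell, [s] in all; agent [N] receives all [s * N] even
    cells. *)
Let cells (i : nat) : nat := if (i < N)%N then s else (s * N)%N.
Let location (i j : nat) : nat :=
  if (i < N)%N then (2 * (j * N + i) + 1)%N else (2 * j)%N.

Let M_gt0 : (0 < M)%N.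
Proof. by rewrite /M !muln_gt0 s_gt0. Qed.

Let cells_gt0 i : (0 < cells i)%N.
Proof. by rewrite /cells; case: ifP; rewrite ?muln_gt0 ?s_gt0. Qed.

Let location_lt i j : (j < cells i)%N -> (location i j < M)%N.
Proof.
rewrite /cells /location /M; case: ifP => iN js; last by rewrite ltn_pmul2l.
have : (j.+1 * N <= s * N)%N by rewrite leq_mul2r js orbT.
rewrite mulSn; lia.
Qed.

Lemma cyclic_instance_cuts : exists I : icd_instance R N.+1,
  forall (c : nat) (D : icd_division R c),
    exact_solution (l%:R / k%:R) I D -> (2 * N * k <= 2 * N + c.+1 * k)%N.
Proof.
have exP (i : 'I_N.+1) := exists_cells_uniform R M_gt0 (cells_gt0 i) (@location_lt i).
have [P PP] := choice exP.
exists (IcdInstance (fun i => (PP i).1)) => c D exactD.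
have mD := measurable_plus_part D.
have avg (i : 'I_N.+1) := esym ((PP i).2 _ mD).
have {}avg i := etrans (avg i) (exactD i).
have [x x0 xle] := exists_offset_le M_gt0 (cells_gt0 _) mD (avg ord_max).
have /choice[y yP] : forall i : 'I_N, exists y : R, cell M 0 y /\
    (q < \sum_(j < s) (((2 * (j * N + i) + 1)%N%:R / M%:R + y)%R \in plus_part D))%N.
  move=> i; have iN : (widen_ord (leqnSn N) i < N)%N by rewrite /= ltn_ord.
  have [y y0 yle] := exists_offset_ge M_gt0 (cells_gt0 _) mD (avg (widen_ord (leqnSn N) i)).
  exists y; split=> //; move: yle; rewrite /cells /location iN /=.
  (* The gain comes from integrality: a count [Z] with [q * k + 1 <= Z * k] is at least [q + 1]. *)
  rewrite mulrAC ler_pdivrMr ?ltr0n// -!natrM ler_nat mulnC slE.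
  move: (\sum_(_ < s) _)%N => Z; nia.
(* The odd cell [2 * t + 1] belongs to agent [t] modulo [N] and is sampled at the offset of that
   agent; all even cells share the offset [x]. Since offsets are positive and at most one cell long,
   the samples alternate. *)
pose z t : R := (2 * t + 1)%N%:R / M%:R + y (Ordinal (ltn_pmod t N_gt0)).
pose v t : R := (2 * t)%N%:R / M%:R + x.
have /andP[x_gt0 x_le] : 0 < x <= M%:R^-1 by rewrite -cell0E.
have y0 i : 0 < y i <= M%:R^-1 by rewrite -cell0E; exact: (yP i).1.
have v_gt0 : 0 < v 0%N by rewrite /v muln0 mul0r add0r.
have vz t : v t <= z t.
  have /andP[y_gt0 _] := y0 (Ordinal (ltn_pmod t N_gt0)).
  by rewrite /v /z natrD mulrDl mul1r; lra.
have zv t : z t <= v t.+1.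
  have /andP[_ y_le] := y0 (Ordinal (ltn_pmod t N_gt0)).
  rewrite /v /z (_ : 2 * t.+1 = 2 * t + 1 + 1)%N; last by lia.
  by rewrite (natrD _ (2 * t + 1) 1) mulrDl mul1r; lra.
(* The closing sample [v (s * N)] equals [1 + x] and lies beyond 1. *)
have := alternating_sample D (s * N) v_gt0 vz zv.
have ge_z : (N * q.+1 <= \sum_(t < s * N) (z t \in plus_part D))%N.
  rewrite (sum_ord_mul (fun t => z t \in plus_part D : nat)).
  rewrite -[X in (X * _)%N]card_ord -sum_nat_const.
  apply: leq_sum => i _; apply: leq_trans (yP i).2 _.
  apply: leq_sum => j _; rewrite /z; set i' := Ordinal _.
  by have -> : i' = i by apply/val_inj; rewrite /= modnMDl modn_small.
have le_v : ((\sum_(t < s * N) (v t \in plus_part D)) * k <= N * (q * k + 1))%N.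
  move: xle; rewrite /cells /location ltnn.
  rewrite mulrAC ler_pdivlMr ?ltr0n// -!natrM ler_nat.
  by rewrite mulnA [(l * s)%N]mulnC slE [X in (_ <= X)%N]mulnC.
move: ge_z le_v; move: (\sum_(_ < _) _)%N (\sum_(_ < _) _)%N => Z V.
nia.
Qed.

End LowerBound.

(** * The lower bound for every number of agents *)

Theorem theorem3p1 (R : realType) (l k : nat) (k_gt0 : (0 < k)%N)
    (l_le_k : (l <= k)%N) (co_lk : coprime l k) :
  exists C : R, 0 <= C /\
    forall n : nat, (0 < n)%N ->
      exists I : icd_instance R n,
        forall (c : nat) (D : icd_division R c),
          exact_solution (l%:R / k%:R) I D ->
          2 * (k%:R - 1) / k%:R * n%:R - C <= c%:R.
Proof.
(* With [n = N.+1], passing from [N] to [n] loses [2 * (k - 1) / k], less than 2, and passing from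
   [c.+1] to [c] loses 1. *)
exists 3; split=> // n n_gt0.
have k0 : 0 < k%:R :> R by rewrite ltr0n.
have [/andP[k_gt1 n_gt1]|small] := boolP ((1 < k) && (1 < n))%N; last first.
  (* For [k = 1] or [n = 1] the main term is at most 2, so any instance will do; here all agents are
     uniform on the unit interval. *)
  have [P [dP _]] :=
    @exists_cells_uniform R 1 1 (fun=> 0%N) isT isT (fun _ _ => isT).
  exists (IcdInstance (fun=> dP)) => c D _.
  suff : 2 * (k%:R - 1) / k%:R * n%:R <= 2 :> R by have := ler0n R c; lra.
  move: small; rewrite negb_and -!leqNgt => /orP[k1|n1].
    by have -> : k = 1%N by [lia]; rewrite subrr mulr0 !mul0r.
  have -> : n = 1%N by lia.
  by rewrite mulr1 ler_pdivrMr//; lra.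
(* If [l = 0], coprimality would force [k = 1]. *)
have l_gt0 : (0 < l)%N.
  by move: co_lk; case: l {l_le_k} => //; rewrite /coprime gcd0n; lia.
have [s [q [slE s_gt0]]] := exists_inverse_mod l_gt0 co_lk.
case: n n_gt0 n_gt1 => [//|N] _ N_gt0.
have [I bound] := cyclic_instance_cuts R N_gt0 k_gt0 s_gt0 slE.
exists I => c D /bound; rewrite -(ler_nat R) natrD !natrM -!natr1 => cN.
rewrite lerBlDr mulrAC ler_pdivrMr//.
nra.
Qed.
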